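(* Let $D$ be a finite, simple, connected (unweighted) digraph with vertex set $V(D)=\{v_1,\dots,v_n\}$, and let $M(D)$ be its middle digraph. Then $$t(M(D))=t(D)\prod_{i=1}^{n}(1+d_i)^{r_i},$$ where $t(\cdot)$ denotes the number of spanning trees of a digraph (over all possible roots), $d_i=d_+(v_i)$ is the number of arcs of $D$ with tail $v_i$, and $r_i=d_-(v_i)$ is the number of arcs of $D$ with head $v_i$.
   Context: Digraphs are finite and simple (no loops, no parallel arcs; opposite arcs $(u,v)$ and $(v,u)$ may both be present). Connected means that the underlying undirected graph is connected. For an arc $e=(u,v)$, $t(e)=u$ is its tail and $h(e)=v$ its head. Spanning tree: a spanning tree of a digraph $D$ is a connected subdigraph containing all vertices of $D$ and having no cycles, in which one vertex (the root) has outdegree $0$ and every other vertex has outdegree $1$ (so arcs point towards the root). Middle digraph: $M(D)$ is the digraph with vertex set $V(D)\cup A(D)$ (disjoint union of the vertex set and the arc set of $D$) whose arcs are: $(v,e)$ for $v\in V(D)$, $e\in A(D)$ with $t(e)=v$; $(e,v)$ for $e\in A(D)$, $v\in V(D)$ with $h(e)=v$; and $(e,f)$ for $e,f\in A(D)$ with $h(e)=t(f)$. *)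

(* Defs.v *)
(* Classical logic (boolp) is only used to count the arc sets satisfying a    *)
(* Prop-valued predicate.                                                     *)
From mathcomp Require Import all_boot.
From mathcomp Require Import boolp.

Set Implicit Arguments.
Unset Strict Implicit.
Unset Printing Implicit Defensive.

(* Using a relation for the arcs excludes parallel arcs but allows opposite   *)
(* ones.                                                                      *)
Record digraph := Digraph {
  vertex :> finType;
  adj : rel vertex;
  adj_irr : irreflexive adj
}.

Definition darc (D : digraph) := {a : D * D | adj a.1 a.2}.

Definition tail (D : digraph) (e : darc D) : D := (val e).1.
Definition head (D : digraph) (e : darc D) : D := (val e).2.

Definition outdeg (D : digraph) (v : D) : nat := #|[set e : darc D | tail e == v]|.
Definition indeg (D : digraph) (v : D) : nat := #|[set e : darc D | head e == v]|.

(* Connectedness of the underlying undirected graph; the empty graph is not   *)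
(* connected.                                                                 *)
Definition weakly_connected (V : finType) (r : rel V) : Prop :=
  0 < #|V| /\ forall x y : V, connect [rel u v | r u v || r v u] x y.

Definition connected (D : digraph) : Prop := weakly_connected (@adj D).

(* [ucycle] accepts the empty sequence, hence the side condition; cycles are  *)
(* directed, and two opposite arcs form one.                                  *)
Definition acyclic (V : finType) (r : rel V) : Prop :=
  forall c : seq V, c <> [::] -> ~ ucycle r c.

(* A subdigraph containing all vertices is given by its set T of arcs.        *)
Definition sub_adj (D : digraph) (T : {set darc D}) : rel D :=
  [rel u v | [exists e in T, (tail e == u) && (head e == v)]].

Definition sub_outdeg (D : digraph) (T : {set darc D}) (v : D) : nat :=
  #|[set e in T | tail e == v]|.

Definition spanning_tree (D : digraph) (T : {set darc D}) : Prop :=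
  [/\ weakly_connected (sub_adj T),
      acyclic (sub_adj T) &
      exists root : D, sub_outdeg T root = 0 /\
        forall v : D, v <> root -> sub_outdeg T v = 1].

Definition nb_spanning_trees (D : digraph) : nat :=
  #|[set T : {set darc D} | `[< spanning_tree T >]]|.

Definition middle_adj (D : digraph) : rel (D + darc D)%type :=
  fun x y => match x, y with
  | inl v, inr e => tail e == v
  | inr e, inl v => head e == v
  | inr e, inr f => head e == tail f
  | inl _, inl _ => false
  end.

Lemma middle_adj_irr (D : digraph) : irreflexive (@middle_adj D).
Proof.
move=> [v|[[u v] /= uv]] //=; rewrite /head /tail /=.
by apply/negP => /eqP vu; move: uv; rewrite vu adj_irr.
Qed.

Definition middle_digraph (D : digraph) : digraph :=
  Digraph (@middle_adj_irr D).

(* Main.v *)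
(* Let L_D be the Laplacian of D.  Expanding det (x + L_D) row by row,        *)
(* according to the arc (or the term x) chosen at each vertex, leaves one     *)
(* term x^k for each spanning forest with k roots, so t(D) is the coefficient *)
(* of x and the constant coefficient is 0.  With T and H the tail and head    *)
(* incidence matrices, x + L_D = A - T H and                                  *)
(*   x + L_M(D) = [A, - T; - H, E - H T]                                      *)
(* with A = diag (x + d_v) and E = diag (x + 1 + d_h(e)).  As E H = H A + H,  *)
(* block elimination gives det (x + L_M(D)) = det (x + L_D) * det E, and it   *)
(* remains to compare the coefficients of x.                                  *)
Require Import Defs.
From mathcomp Require Import all_boot all_fingroup all_algebra.
From mathcomp Require Import boolp.

Set Implicit Arguments.
Unset Strict Implicit.
Unset Printing Implicit Defensive.

Import GRing.Theory.

(** Each term of the row-by-row expansion chooses at every vertex an out-arc or the term x, that is,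
    a partial function [g]. The resulting determinant is 1 if every vertex leads to a root and 0
    otherwise ([det_forest_mx]), whence [det_laplacian_mx]. With x the indeterminate over the
    integers, a forest with k roots counts as X^k, and the one-rooted forests are the spanning trees
    ([nb_spanning_treesE]). Passing to the middle digraph multiplies this polynomial by the product
    over arcs e of X + 1 + d_h(e) ([det_laplacian_middle]). As the constant term vanishes, the
    coefficient of X is multiplied by the value of that product at 0, where each vertex occurs once
    per arc entering it ([prod_head]). *)

(* [g v = None] makes v a root, [g v = Some w] selects the arc (v, w). *)
Definition succ_rel (V : finType) (g : {ffun V -> option V}) : rel V :=
  [rel u v | g u == Some v].

Definition forest (V : finType) (g : {ffun V -> option V}) : bool :=
  [forall v, exists r, connect (succ_rel g) v r && (g r == None)].

Definition root_set (V : finType) (g : {ffun V -> option V}) : {set V} :=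
  [set v | g v == None].

(** Following [g] from [v] stays in [A] and stops at a root. Applied to a root-free invariant set,
    such as a cycle, this gives a contradiction. *)
Lemma forest_invariant_root (V : finType) (g : {ffun V -> option V}) (A : pred V)
    (v : V) :
  forest g -> A v -> (forall u w, A u -> g u = Some w -> A w) ->
  exists2 r, A r & g r = None.
Proof.
move=> /forallP/(_ v)/existsP[r /andP[/connectP[p pP ->] /eqP gr]] Av closA.
exists (last v p) => //.
elim: p v pP Av {gr} => //= w p IHp v /andP[/eqP gv pP] Av.
by apply: IHp => //; apply: closA gv.
Qed.

(** * Forest expansion of the determinant of the shifted Laplacian *)

Section ForestDeterminant.
Local Open Scope ring_scope.
Variables (R : comNzRingType) (V : finType) (n : nat) (h : 'I_n -> V).
Hypothesis h_bij : bijective h.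
Implicit Type g : {ffun V -> option V}.

Let h_inj : injective h := bij_inj h_bij.

Definition forest_mx g : 'M[R]_n :=
  \matrix_(i, j) ((h i == h j)%:R - (g (h i) == Some (h j))%:R).

(** For a forest only the identity permutation contributes, since any other one would trace cycles
    of [g]. Otherwise a nonzero 0/1 vector lies in the kernel. *)
Lemma det_forest_mx g : \det (forest_mx g) = (forest g)%:R.
Proof.
case: (boolP (forest g)) => [fg | nfg].
  rewrite /determinant (bigD1 1%g) //= odd_perm1 mul1r.
  rewrite [X in _ + X]big1 ?addr0 => [|s s1].
    apply: big1 => i _; rewrite mxE perm1 eqxx.
    case: eqP => [gi|_]; last by rewrite subr0.
    (* A loop of [g] at [h i] would be an invariant singleton without a root. *)
    have [|r /eqP ->] := forest_invariant_root (A := pred1 (h i)) fg (eqxx _).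
      by move=> u w /eqP-> ; rewrite gi => -[->]; exact: eqxx.
    by rewrite gi.
  suff /existsP[i /eqP si0] : [exists i, forest_mx g i (s i) == 0].
    by rewrite (bigD1 i) //= si0 mul0r mulr0.
  apply: contraNT s1; rewrite negb_exists => /forallP nz.
  (* The points moved by s would form a union of cycles of g. *)
  have gs i : s i != i -> g (h i) = Some (h (s i)).
    move=> si; have := nz i; rewrite mxE (inj_eq h_inj) (eq_sym i) (negPf si).
    by case: (g (h i) =P _) => // _; rewrite subrr eqxx.
  apply/eqP/permP => i; rewrite perm1; apply/eqP/negPn/negP => si.
  pose A v := [exists j, (s j != j) && (h j == v)].
  have Ai : A (h i) by apply/existsP; exists i; rewrite si eqxx.
  have [u w /existsP[j /andP[sj /eqP<-]]|r /existsP[j /andP[sj /eqP<-]]] :=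
      forest_invariant_root fg Ai.
    rewrite gs // => -[<-]; apply/existsP; exists (s j).
    by rewrite (inj_eq perm_inj) sj eqxx.
  by rewrite gs.
move: nfg; rewrite negb_forall => /existsP[v nv].
(* The indicator of the vertices that reach no root is in the kernel. *)
pose bad u := ~~ [exists r, connect (succ_rel g) u r && (g r == None)].
pose x : 'cV[R]_n := \col_j (bad (h j))%:R.
have [h' hK h'K] := h_bij.
(* A root is not bad, and any other vertex is bad exactly when its successor is. *)
have kx : forest_mx g *m x = 0.
  apply/matrixP => i k; rewrite !mxE.
  under eq_bigr do rewrite !mxE mulrBl -!natrM !mulnb.
  rewrite sumrB (bigD1 i) //= eqxx big1 => [|j /negPf ji]; last first.
    by rewrite (inj_eq h_inj) (eq_sym i) ji.
  rewrite addr0 /=.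
  case gi: (g (h i)) => [w|]; last first.
    rewrite big1 ?subr0 // -[RHS]/(false%:R); congr (_%:R); congr nat_of_bool.
    apply/negbF/existsP; exists (h i).
    by rewrite connect0 gi.
  rewrite (bigD1 (h' w)) //= h'K eqxx big1 => [|j ji]; last first.
    case: eqP => // -[wj]; case/negP: ji; apply/eqP; apply: h_inj.
    by rewrite h'K.
  rewrite addr0 /=; apply/eqP; rewrite subr_eq0; apply/eqP.
  congr (_%:R); congr nat_of_bool; congr negb.
  apply/existsP/existsP => -[r /andP[cr /eqP gr]]; exists r; rewrite gr eqxx andbT.
    case/connectP: cr gr => -[|u p] /=; first by move=> _ ->; rewrite gi.
    case/andP; rewrite {1}/succ_rel /= gi => /eqP[->] pP -> _.
    by apply/connectP; exists p.
  by apply: connect_trans cr; apply: connect1; rewrite /succ_rel /= gi.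
(* The adjugate yields det * x = 0, and x has entry 1 at the bad vertex [v]; this works over any
   commutative ring. *)
have : \adj (forest_mx g) *m (forest_mx g *m x) = 0 by rewrite kx mulmx0.
rewrite mulmxA mul_adj_mx mul_scalar_mx => /matrixP/(_ (h' v) 0).
by rewrite !mxE h'K /bad nv mulr1.
Qed.

(** The enumeration [h] is kept arbitrary so that the vertices of D can be listed before its arcs in
    the middle digraph. *)
Definition laplacian_mx (x : R) (r : rel V) : 'M[R]_n :=
  \matrix_(i, j) ((x + #|r (h i)|%:R) *+ (h i == h j) - (r (h i) (h j))%:R).

Definition arc_weight (x : R) (r : rel V) (v : V) (c : option V) : R :=
  if c is Some w then (r v w)%:R else x.

(** Each row is a weighted sum of possible rows of forest matrices, ready for multilinearity. *)
Lemma laplacian_mxE x r i j :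
  laplacian_mx x r i j =
  \sum_c arc_weight x r (h i) c * ((h i == h j)%:R - (c == Some (h j))%:R).
Proof.
have sum_opt (F : option V -> R) : \sum_c F c = F None + \sum_w F (Some w).
  by rewrite ![index_enum _]unlock [@Finite.enum in LHS]unlock /= big_cons big_map.
rewrite sum_opt /= subr0 mxE.
under eq_bigr do rewrite mulrBr.
rewrite sumrB -mulr_suml [X in _ = _ + (_ - X)](bigD1 (h j)) //= eqxx mulr1.
rewrite [X in _ = _ + (_ - (_ + X))]big1 => [|w /negPf wj]; last first.
  by rewrite -[_ == _]/(w == h j) wj mulr0.
by rewrite addr0 addrA -mulrDl -natr_sum -sum1_card big_mkcond mulr_natr.
Qed.

Lemma det_laplacian_mx x r :
  \det (laplacian_mx x r) =
  \sum_(g : {ffun V -> option V} | forest g) \prod_v arc_weight x r v (g v).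
Proof.
have [h' hK h'K] := h_bij.
have h'_bij : bijective h' by exists h.
pose G (g : {ffun V -> option V}) := \prod_v arc_weight x r v (g v).
transitivity (\sum_g G g * \det (forest_mx g)); last first.
  rewrite [RHS]big_mkcond; apply: eq_bigr => g _; rewrite det_forest_mx.
  by case: ifP; rewrite ?mulr1 ?mulr0.
rewrite /determinant; under [RHS]eq_bigr do rewrite mulr_sumr.
rewrite exchange_big; apply: eq_bigr => s _ /=.
under [RHS]eq_bigr do rewrite mulrCA.
rewrite -mulr_sumr; congr (_ * _).
under eq_bigr do rewrite laplacian_mxE.
rewrite (reindex h') /=; last exact: onW_bij.
under eq_bigr do rewrite h'K.
rewrite bigA_distr_bigA; apply: eq_bigr => g _; rewrite big_split /=.
congr (_ * _); rewrite (reindex h) /=; last exact: onW_bij.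
by apply: eq_bigr => i _; rewrite hK mxE.
Qed.

End ForestDeterminant.

(** * Block elimination in the Laplacian of the middle digraph *)

Section MiddleDigraph.
Local Open Scope ring_scope.
Variables (R : comNzRingType) (D : digraph) (x : R).

Let p := #|D|.
Let q := #|{: darc D}|.

Definition vertex_of_ord : 'I_p -> D := enum_val.
Definition arc_of_ord : 'I_q -> darc D := enum_val.

Definition middle_of_ord (i : 'I_(p + q)) : middle_digraph D :=
  match split i with
  | inl j => inl (vertex_of_ord j)
  | inr k => inr (arc_of_ord k)
  end.

Lemma middle_of_ord_bij : bijective middle_of_ord.
Proof.
exists (fun y => match y with
  | inl v => lshift q (enum_rank v) | inr e => rshift p (enum_rank e) end).
  move=> i; rewrite /middle_of_ord -{2}(splitK i).
  by case: (split i) => j /=; rewrite enum_valK.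
move=> [v|e]; rewrite /middle_of_ord.
  by rewrite (unsplitK (inl _)) /vertex_of_ord enum_rankK.
by rewrite (unsplitK (inr _)) /arc_of_ord enum_rankK.
Qed.

(** There are no parallel arcs, so [tail_mx *m head_mx] is the adjacency matrix. *)
Lemma sum_arc_between (v w : D) :
  (\sum_(e : darc D) ((tail e == v) && (Defs.head e == w)) = adj v w)%N.
Proof.
case vw: (adj v w); last first.
  apply: big1 => -[[a b] /= ab] _; rewrite /tail /Defs.head /=.
  by case: eqP ab => //= ->; case: eqP => // ->; rewrite vw.
pose e0 : darc D := exist _ (v, w) vw.
rewrite (bigD1 e0) //= /tail /Defs.head /= !eqxx big1 // => e.
rewrite -val_eqE /=; case: (val e) => a b /=.
by rewrite xpair_eqE => /negPf->.
Qed.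

Lemma card_adj (v : D) : #|adj v| = outdeg v.
Proof.
rewrite /outdeg -!sum1_card [LHS]big_mkcond [RHS]big_mkcond /=.
under eq_bigr => w _ do
  rewrite -[if _ then _ else _]/(nat_of_bool (adj v w)) -sum_arc_between.
rewrite exchange_big; apply: eq_bigr => e _ /=.
rewrite inE (bigD1 (Defs.head e)) //= eqxx andbT big1 ?addn0 => [|w].
  by case: eqP.
by rewrite eq_sym => /negPf->; rewrite andbF.
Qed.

Lemma card_middle_adj_vertex (v : D) :
  #|middle_adj (inl v : D + darc D)| = outdeg v.
Proof.
rewrite /outdeg -!sum1_card big_sumType /= big_pred0 // add0n.
by apply: eq_bigl => e; rewrite !inE.
Qed.

(** The extra 1 is the arc from [e] to its own head; it is the source of the factors 1 + d. *)
Lemma card_middle_adj_arc (e : darc D) :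
  #|middle_adj (inr e : D + darc D)| = (outdeg (Defs.head e)).+1.
Proof.
rewrite /outdeg -!sum1_card big_sumType /= -[RHS]add1n; congr (_ + _)%N.
  by rewrite (big_pred1 (Defs.head e)) // => v; rewrite /= eq_sym.
by apply: eq_bigl => f; rewrite !inE eq_sym.
Qed.

Definition tail_mx : 'M[R]_(p, q) :=
  \matrix_(i, k) (tail (arc_of_ord k) == vertex_of_ord i)%:R.
Definition head_mx : 'M[R]_(q, p) :=
  \matrix_(k, i) (Defs.head (arc_of_ord k) == vertex_of_ord i)%:R.
Definition vertex_diag : 'M[R]_p :=
  diag_mx (\row_i (x + (outdeg (vertex_of_ord i))%:R)).
Definition arc_diag : 'M[R]_q :=
  diag_mx (\row_k (x + (outdeg (Defs.head (arc_of_ord k))).+1%:R)).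

Lemma laplacian_adjE :
  laplacian_mx vertex_of_ord x (@adj D) = vertex_diag - tail_mx *m head_mx.
Proof.
apply/matrixP => i j; rewrite !mxE card_adj (inj_eq enum_val_inj); congr (_ - _).
under eq_bigr do rewrite !mxE -natrM mulnb.
rewrite -natr_sum -sum_arc_between; congr (_%:R).
by rewrite [LHS](reindex arc_of_ord) //; apply/onW_bij/enum_val_bij.
Qed.

Lemma laplacian_middleE :
  laplacian_mx middle_of_ord x (@adj (middle_digraph D)) =
  block_mx vertex_diag (- tail_mx) (- head_mx) (arc_diag - head_mx *m tail_mx).
Proof.
have inlE i : middle_of_ord (lshift q i) = inl (vertex_of_ord i).
  by rewrite /middle_of_ord (unsplitK (inl _)).
have inrE k : middle_of_ord (rshift p k) = inr (arc_of_ord k).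
  by rewrite /middle_of_ord (unsplitK (inr _)).
rewrite -[LHS]submxK; congr block_mx; apply/matrixP => i j; rewrite !mxE ?inlE ?inrE.
- rewrite card_middle_adj_vertex subr0; congr (_ *+ _); congr nat_of_bool.
  by rewrite -[LHS]/(vertex_of_ord i == vertex_of_ord j) (inj_eq enum_val_inj).
- by rewrite mulr0n sub0r.
- by rewrite mulr0n sub0r.
rewrite card_middle_adj_arc; congr (_ *+ _ - _).
  congr nat_of_bool.
  by rewrite -[LHS]/(arc_of_ord i == arc_of_ord j) (inj_eq enum_val_inj).
under eq_bigr do rewrite !mxE -natrM mulnb.
rewrite (bigD1 (enum_rank (Defs.head (arc_of_ord i)))) //=.
rewrite /vertex_of_ord enum_rankK eqxx big1 => [|k /negPf ki].
  by rewrite addr0 eq_sym.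
by case: (Defs.head (arc_of_ord i) =P enum_val k) ki => // ->; rewrite enum_valK eqxx.
Qed.

Lemma det_laplacian_middle :
  \det (laplacian_mx middle_of_ord x (@adj (middle_digraph D))) =
  \det (laplacian_mx vertex_of_ord x (@adj D)) *
  \prod_(e : darc D) (x + (outdeg (Defs.head e)).+1%:R).
Proof.
have EH : arc_diag *m head_mx = head_mx *m vertex_diag + head_mx.
  rewrite mul_diag_mx mul_mx_diag; apply/matrixP => k i; rewrite !mxE.
  case: eqP => [->|_]; last by rewrite mul0r mulr0 addr0.
  by rewrite mulr1 mul1r -natr1 addrA.
(* The row operation makes the lower blocks - E H and E, so E factors out on the left without being
   inverted. *)
have L1 : block_mx 1%:M 0 (- head_mx) 1%:M *m
    laplacian_mx middle_of_ord x (@adj (middle_digraph D)) =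
    block_mx 1%:M 0 0 arc_diag *m block_mx vertex_diag (- tail_mx) (- head_mx) 1%:M.
  rewrite laplacian_middleE !mulmx_block !mul1mx !mul0mx !addr0 !add0r mulmx1.
  rewrite !mulmxN !mulNmx opprK EH opprD; congr block_mx.
  by rewrite addrC subrK.
(* The column operation clears the lower left block and leaves A - T H in the corner. *)
have L2 : block_mx vertex_diag (- tail_mx) (- head_mx) 1%:M *m
    block_mx 1%:M 0 head_mx 1%:M =
    block_mx (laplacian_mx vertex_of_ord x (@adj D)) (- tail_mx) 0 1%:M.
  rewrite laplacian_adjE mulmx_block !mulmx1 !mulmx0 !add0r mulNmx mul1mx.
  by rewrite addNr.
have := congr1 determinant L1; have := congr1 determinant L2.
rewrite !det_mulmx !det_lblock det_ublock !det1 !mulr1 !mul1r => -> ->.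
rewrite mulrC det_diag; congr (_ * _).
rewrite [RHS](reindex arc_of_ord); last by apply/onW_bij/enum_val_bij.
by apply: eq_bigr => k _; rewrite mxE.
Qed.

End MiddleDigraph.

(** * Spanning trees as partial successor functions with one root *)

Definition arcs_in (V : finType) (r : rel V) (g : {ffun V -> option V}) : bool :=
  [forall v, if g v is Some w then r v w else true].

Definition rooted_trees (V : finType) (r : rel V) : {set {ffun V -> option V}} :=
  [set g | [&& forest g, arcs_in r g & #|root_set g| == 1]].

Section SpanningTrees.
Variable D : digraph.
Implicit Types (g : {ffun D -> option D}) (T : {set darc D}).

Definition graph_arcs g : {set darc D} :=
  [set e | g (tail e) == Some (Defs.head e)].

Lemma sub_adj_graph_arcs g :
  arcs_in (@adj D) g -> sub_adj (graph_arcs g) =2 succ_rel g.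
Proof.
move=> /forallP ag u v; apply/existsP/idP => [[e]|/= /eqP gu].
  by rewrite inE => /andP[/eqP ge /andP[/eqP<- /eqP<-]]; rewrite /succ_rel /= ge.
have uv : adj u v by have := ag u; rewrite gu.
exists (exist _ (u, v) uv : darc D).
by rewrite inE /tail /Defs.head /= gu !eqxx.
Qed.

Lemma sub_outdeg_graph_arcs g v :
  arcs_in (@adj D) g -> sub_outdeg (graph_arcs g) v = (g v != None).
Proof.
move=> /forallP/(_ v) ag; rewrite /sub_outdeg.
case gv: (g v) ag => [w|] vw; last first.
  apply/eqP; rewrite cards_eq0; apply/eqP/setP => e; rewrite !inE.
  by apply/negbTE/negP => /andP[/eqP ge /eqP te]; rewrite te gv in ge.
pose e0 : darc D := exist _ (v, w) vw.
rewrite -[RHS]/1 -(cards1 e0); congr #|pred_of_set _|; apply/setP => e; rewrite !inE.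
apply/andP/eqP => [[/eqP ge /eqP te]|->]; last first.
  by rewrite /tail /Defs.head /= gv !eqxx.
move: ge; rewrite te gv => -[wh]; apply: val_inj; rewrite /= wh -te.
exact: surjective_pairing.
Qed.

Lemma graph_arcs_inj : {in [pred g | arcs_in (@adj D) g] &, injective graph_arcs}.
Proof.
move=> g1 g2 a1 a2 eqT; apply/ffunP => v.
have eqr w : (g1 v == Some w) = (g2 v == Some w).
  by rewrite -[LHS]/(succ_rel g1 v w) -sub_adj_graph_arcs // eqT
             sub_adj_graph_arcs.
case g1v: (g1 v) => [w|]; first by apply/esym/eqP; rewrite -eqr g1v.
case g2v: (g2 v) => [w|] //.
by have := eqr w; rewrite g1v g2v eqxx.
Qed.

Lemma spanning_tree_graph_arcs g :
  g \in rooted_trees (@adj D) -> spanning_tree (graph_arcs g).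
Proof.
rewrite inE => /and3P[fg ag /cards1P[r rg]].
have rootE v : (g v == None) = (v == r).
  by have := congr1 (fun A : {set D} => v \in A) rg; rewrite !inE.
have eqr := sub_adj_graph_arcs ag.
split.
- split; first by apply/card_gt0P; exists r.
  have to_root v : connect [rel u v | sub_adj (graph_arcs g) u v
      || sub_adj (graph_arcs g) v u] v r.
    have /existsP[s /andP[vs]] := forallP fg v.
    rewrite rootE => /eqP sr; rewrite -{}sr.
    apply: connect_sub vs => u w uw; apply: connect1.
    by rewrite /= eqr uw.
  move=> x y; apply: connect_trans (to_root x) _.
  by rewrite sym_connect_sym // => u v /=; rewrite orbC.
- move=> c c0 /andP[cyc _].
  case: c c0 cyc => // x c _ cyc.
  (* The vertices of a cycle form an invariant set: the successor of each is the next one on the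
     cycle, so none is a root. *)
  have [|u w uc gu|s sc gs] := forest_invariant_root (v := x) (A := mem (x :: c)) fg.
  + exact: mem_head.
  + have nc : next (x :: c) u \in x :: c by rewrite mem_next.
    have := next_cycle cyc uc; rewrite eqr /succ_rel [in X in X -> _]/= gu.
    by move=> /eqP[->]; exact: nc.
  + by have := next_cycle cyc sc; rewrite eqr /succ_rel /= gs.
exists r; rewrite sub_outdeg_graph_arcs // rootE eqxx; split=> // v /eqP vr.
by rewrite sub_outdeg_graph_arcs // rootE vr.
Qed.

(** Outdegree at most 1 makes [T] the graph of a partial function, and weak connectedness forces
    every vertex to lead to the root. *)
Lemma spanning_treeP T :
  spanning_tree T -> exists2 g, g \in rooted_trees (@adj D) & T = graph_arcs g.
Proof.
move=> [[_ conT] _ [r [out0 out1]]].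
have sub_adjP u v : sub_adj T u v -> exists e, [/\ e \in T, tail e = u & Defs.head e = v].
  by move=> /existsP[e /and3P[eT /eqP te /eqP he]]; exists e.
have sub_adjI e : e \in T -> sub_adj T (tail e) (Defs.head e).
  by move=> eT; apply/existsP; exists e; rewrite eT !eqxx.
have rT e : e \in T -> tail e <> r.
  move=> eT te; move/eqP: out0; rewrite cards_eq0 => /eqP/setP/(_ e).
  by rewrite !inE eT te eqxx.
have out_inj e f : e \in T -> f \in T -> tail e = tail f -> e = f.
  move=> eT fT ef; have /eqP/cards1P[a /setP aE] := out1 _ (rT _ eT).
  move: (aE e) (aE f); rewrite !inE eT fT -ef eqxx /=.
  by move=> /esym/eqP-> /esym/eqP->.
pose g : {ffun D -> option D} := [ffun v => [pick w | sub_adj T v w]].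
have gE v w : (g v == Some w) = sub_adj T v w.
  rewrite ffunE; case: pickP => [w' vw'|-> //].
  apply/eqP/idP => [[<-//]|vw]; congr Some.
  have [e [eT te <-]] := sub_adjP _ _ vw'; have [f [fT tf <-]] := sub_adjP _ _ vw.
  by congr Defs.head; apply: out_inj; rewrite ?te.
have gr : g r = None.
  case gr: (g r) => [w|] //; move/eqP: gr; rewrite gE => /sub_adjP[e [eT te _]].
  by case: (rT e eT).
have gT : T = graph_arcs g.
  apply/setP => e; rewrite inE gE; apply/idP/idP => [/sub_adjI //|].
  move=> /sub_adjP[f [fT tf hf]]; suff -> : e = f by [].
  apply: val_inj; move: tf hf; rewrite /tail /Defs.head.
  by case: (val e) (val f) => [a b] [a' b'] /= -> ->.
exists g => //; rewrite inE; apply/and3P; split.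
- apply/forallP => v.
  have [p pP ->] := connectP (conT r v).
  (* Leading to [r] propagates along undirected paths starting at [r]. Across an arc taken backwards
     this is clear; across an arc (u, w), [w] is the only successor of [u] and so lies on its path
     to [r]. *)
  suff reach u : connect (succ_rel g) u r ->
      path [rel u v | sub_adj T u v || sub_adj T v u] u p ->
      connect (succ_rel g) (last u p) r.
    by apply/existsP; exists r; rewrite reach // gr eqxx.
  elim: p {pP} u => //= w p IHp u ur /andP[uw pP]; apply: IHp => //.
  case/orP: uw => [uw|wu]; last first.
    by apply: connect_trans ur; apply: connect1; rewrite /succ_rel /= gE.
  have /eqP gu : g u == Some w by rewrite gE.
  case/connectP: ur => -[|w' q] /=; first by move=> _ ru; move: gu; rewrite -ru gr.
  case/andP; rewrite {1}/succ_rel /= gu => /eqP[<-] qP ->.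
  by apply/connectP; exists q.
- apply/forallP => v; case gv: (g v) => [w|] //.
  move/eqP: gv; rewrite gE => /sub_adjP[e [_ <- <-]]; exact: (valP e).
apply/cards1P; exists r; apply/setP => v; rewrite !inE.
apply/eqP/eqP => [gv|->//]; apply: contrapT => /out1 /eqP/cards1P[e /setP/(_ e)].
rewrite !inE eqxx => /andP[/sub_adjI eT /eqP te].
by move: eT; rewrite -gE te gv.
Qed.

Lemma nb_spanning_treesE : nb_spanning_trees D = #|rooted_trees (@adj D)|.
Proof.
rewrite /nb_spanning_trees -(card_in_imset (f := graph_arcs)); last first.
  move=> g1 g2; rewrite !inE => /and3P[_ a1 _] /and3P[_ a2 _].
  exact: graph_arcs_inj.
congr #|pred_of_set _|; apply/setP => T; rewrite inE; apply/asboolP/imsetP.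
  by move=> /spanning_treeP[g]; exists g.
by move=> [g gP ->]; apply: spanning_tree_graph_arcs.
Qed.

End SpanningTrees.

(** * Low coefficients of the Laplacian polynomial *)

Section LaplacianPolynomial.
Local Open Scope ring_scope.
Variables (V : finType) (n : nat) (h : 'I_n -> V) (r : rel V).
Hypothesis h_bij : bijective h.

Let char : {poly int} := \det (laplacian_mx h 'X r).

(** A choice that uses a non-arc has weight 0; otherwise each root contributes X and each arc 1. *)
Lemma laplacian_polyE :
  char = \sum_(g | forest g && arcs_in r g) 'X^#|root_set g|.
Proof.
rewrite /char det_laplacian_mx // big_mkcondr; apply: eq_bigr => g _.
case: ifP => [/forallP ag|/negbT]; last first.
  rewrite negb_forall => /existsP[v]; case gv: (g v) => [w|] // /negPf vw.
  by rewrite (bigD1 v) //= gv /= vw mul0r.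
rewrite (bigID (mem (root_set g))) /= mulrC big1 => [|v].
  rewrite mul1r -prodr_const; apply: eq_bigr => v; rewrite inE.
  by move=> /eqP->.
by rewrite inE; have := ag v; case: (g v) => [w|] //= ->.
Qed.

(** A forest on a nonempty vertex set has at least one root. *)
Lemma laplacian_poly_coef0 : (0 < #|V|)%N -> char`_0 = 0.
Proof.
move=> /card_gt0P[v _]; rewrite laplacian_polyE coef_sum big1 // => g /andP[fg _].
rewrite coefXn; have /existsP[s /andP[_ gs]] := forallP fg v.
suff : #|root_set g| != 0%N by rewrite eq_sym => /negPf->.
by rewrite cards_eq0; apply/set0Pn; exists s; rewrite inE.
Qed.

Lemma laplacian_poly_coef1 : char`_1 = #|rooted_trees r|%:R.
Proof.
rewrite laplacian_polyE coef_sum -sum1_card natr_sum [RHS]big_mkcond.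
rewrite [LHS]big_mkcond; apply: eq_bigr => g _; rewrite inE andbA coefXn.
by rewrite eq_sym; case: (_ && _) => //=; case: eqP.
Qed.

End LaplacianPolynomial.

(** * Comparison of the coefficients of X *)

Lemma prod_head (D : digraph) (F : D -> nat) :
  \prod_(e : darc D) F (Defs.head e) = \prod_(v : D) F v ^ indeg v.
Proof.
rewrite (partition_big (@Defs.head D) xpredT) //=; apply: eq_bigr => v _.
rewrite -prod_nat_const; apply: congr_big => // e; first by rewrite inE.
by move=> /eqP->.
Qed.

Theorem corollary6 (D : digraph) (hD : connected D) :
  nb_spanning_trees (middle_digraph D) =
    nb_spanning_trees D * \prod_(v : D) (1 + outdeg v) ^ indeg v.
Proof.
have [D0 _] := hD.
have hbij : bijective (@vertex_of_ord D) by apply: enum_val_bij.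
have /(congr1 (fun P : {poly int} => P`_1)%R) :=
  det_laplacian_middle D ('X : {poly int})%R.
rewrite (laplacian_poly_coef1 _ (@middle_of_ord_bij D)).
(* The coefficient of X in P Q is P_0 Q_1 + P_1 Q_0, with P_0 = 0; then Q_0 is computed by
   evaluating the product at 0. *)
rewrite coefM big_ord_recr big_ord1 /= subn0 subnn.
rewrite (laplacian_poly_coef0 _ hbij D0) mul0r add0r.
rewrite (laplacian_poly_coef1 _ hbij) -horner_coef0 horner_prod.
under eq_bigr do rewrite hornerD hornerX add0r -polyC_natr hornerC.
rewrite -natr_prod -natrM => /eqP; rewrite Num.Theory.eqr_nat => /eqP.
rewrite !nb_spanning_treesE => ->; congr (_ * _).
exact: (prod_head (fun v => 1 + outdeg v)).
Qed.
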